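(* Let $A,B\in\mathbb{B}(\mathscr{H})$ with $B\stackrel{*}{\leq}A$, and let $X\in\mathbb{B}(\mathscr{H})$. Then the following statements are equivalent: (a) $X$ is a solution of the system $BXA=B=AXB$; (b) $B\stackrel{*}{\leq}AXA$.
   Context: $\mathscr{H}$ is a complex Hilbert space and $\mathbb{B}(\mathscr{H})$ is the space of bounded linear operators on $\mathscr{H}$. For $C,D\in\mathbb{B}(\mathscr{H})$, the $*$-order $C\stackrel{*}{\leq}D$ means $CC^*=DC^*$ and $C^*C=C^*D$. *)

(* Defs.v *)
From HB Require Import structures.
From mathcomp Require Import all_boot all_order all_algebra complex.
From mathcomp Require Import all_classical all_reals all_analysis.

Set Implicit Arguments.
Unset Strict Implicit.
Unset Printing Implicit Defensive.

Import Order.TTheory GRing.Theory Num.Theory.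
Import numFieldNormedType.Exports.

Local Open Scope classical_set_scope.
Local Open Scope complex_scope.
Local Open Scope ring_scope.

HB.mixin Record CompleteNormedModule_isHilbert (R : realType) (H : Type)
    of CompleteNormedModule R[i] H := {
  inner : H -> H -> R[i] ;
  inner_linearl : forall (a : R[i]) (x y z : H),
    inner (a *: x + y) z = a * inner x z + inner y z ;
  inner_conj : forall x y : H, inner y x = Num.conj (inner x y) ;
  inner_norm : forall x : H, inner x x = `|x| ^+ 2
}.

#[short(type="hilbertType")]
HB.structure Definition Hilbert (R : realType) :=
  {H of CompleteNormedModule_isHilbert R H & CompleteNormedModule R[i] H}.

Section InnerProduct.
Context {R : realType} {H : hilbertType R}.

Let inner_bilinear : bilinear_for
  (GRing.Scale.Law.clone _ _ *%R _)
  (GRing.Scale.Law.clone _ _ (Num.conj \; *%R) _) (@inner R H).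
Proof.
split=> [z a x y|z a x y] /=; first exact: inner_linearl.
rewrite inner_conj inner_linearl rmorphD rmorphM /=.
by rewrite -!(inner_conj _ z).
Qed.

HB.instance Definition _ :=
  bilinear_isBilinear.Build R[i] H H R[i] _ _ (@inner R H) inner_bilinear.

Let inner_hermitian (x y : H) :
  inner x y = (-1) ^+ false * Num.conj (inner y x).
Proof. by rewrite mul1r -inner_conj. Qed.

HB.instance Definition _ :=
  isHermitianSesquilinear.Build R[i] H false Num.conj (@inner R H)
    inner_hermitian.

Let inner_gt0 (x : H) : x != 0 -> 0 < inner x x.
Proof. by move=> x_neq0; rewrite inner_norm exprn_gt0// normr_gt0. Qed.

HB.instance Definition _ := isDotProduct.Build R[i] H (@inner R H) inner_gt0.

End InnerProduct.

Section BoundedOperators.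
Context {R : realType} {H : hilbertType R}.

Record boundedOp := BoundedOp {
  boundedOp_fun :> {linear H -> H} ;
  boundedOpP : exists M : R, forall x, `|boundedOp_fun x| <= M%:C * `|x|
}.
Implicit Types S T : boundedOp.

HB.instance Definition _ := gen_eqMixin boundedOp.
HB.instance Definition _ := gen_choiceMixin boundedOp.

Lemma boundedOp_eqP S T : S = T <-> S =1 T.
Proof.
split=> [->//|]; case: S T => [S S_bd] [T T_bd] /= /funext eqST.
have {}eqST : S = T.
  case: S T eqST {S_bd T_bd} => [S [[SD] [SZ]]] [T [[TD] [TZ]]] /= eqST.
  case: _ / eqST in TD TZ *.
  by rewrite (Prop_irrelevance SD TD) (Prop_irrelevance SZ TZ).
case: _ / eqST in T_bd *; congr BoundedOp; exact: Prop_irrelevance.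
Qed.

Fact zero_op_bounded :
  exists M : R, forall x, `|(\0 : {linear H -> H}) x| <= M%:C * `|x|.
Proof. by exists 0 => x; rewrite /= normr0 mul0r. Qed.

Definition zero_op : boundedOp := BoundedOp zero_op_bounded.

Fact comp_op_bounded S T : exists M : R, forall x,
  `|(boundedOp_fun S \o boundedOp_fun T : {linear H -> H}) x| <= M%:C * `|x|.
Proof.
have [[M SM] [N TN]] := (boundedOpP S, boundedOpP T).
exists (Num.max M 0 * Num.max N 0) => x /=.
apply: le_trans (SM _) _; rewrite rmorphM /= -mulrA.
apply: (@le_trans _ _ ((Num.max M 0)%:C * `|T x|)).
  by rewrite ler_wpM2r ?normr_ge0 // lecR le_max lexx.
rewrite ler_wpM2l ?lecR ?le_max ?lexx ?orbT //.
apply: le_trans (TN _) _.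
by rewrite ler_wpM2r ?normr_ge0 // lecR le_max lexx.
Qed.

Definition comp_op S T : boundedOp := BoundedOp (comp_op_bounded S T).

Definition is_adjoint T S := forall x y : H, inner (T x) y = inner x (S y).

Lemma is_adjoint_unique T S S' : is_adjoint T S -> is_adjoint T S' -> S = S'.
Proof.
move=> TS TS'; apply/boundedOp_eqP => y; apply/eqP; rewrite -subr_eq0.
rewrite -normr_eq0 -sqrf_eq0 -inner_norm.
by rewrite linearBr /= -TS -TS' subrr.
Qed.

(* By the Riesz representation theorem every bounded operator has exactly one
   bounded adjoint, so the default value zero_op is never reached. *)
Definition adjoint T : boundedOp := xget zero_op [set S | is_adjoint T S].

End BoundedOperators.
Arguments boundedOp {R} H.

Notation "''B(' H )" := (boundedOp H) (format "''B(' H )") : type_scope.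

Declare Scope operator_scope.
Delimit Scope operator_scope with Op.
Bind Scope operator_scope with boundedOp.

Notation "S * T" := (comp_op S T) : operator_scope.
Notation "T ^*" := (adjoint T) : operator_scope.

Definition star_le {R : realType} {H : hilbertType R} (C D : 'B(H)) : Prop :=
  (C * C^* = D * C^* /\ C^* * C = C^* * D)%Op.

Notation "C <=* D" := (star_le C%Op D%Op)
  (at level 70, no associativity) : operator_scope.

(* Main.v *)
From HB Require Import structures.
Require Import Defs.
From mathcomp Require Import all_boot all_order all_algebra complex.
From mathcomp Require Import all_classical all_reals all_analysis.
From mathcomp Require Import ring lra.

(** Write [B <=* A] as [B B^* = A B^*] and [B^* B = B^* A]. The system gives
    the star order by multiplying it by [B^*]: since [A B^* = B B^*],
    [A X A B^* = (A X B) B^* = B B^*], and symmetrically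
    [B^* A X A = B^* (B X A) = B^* B].

    The same computation read backwards turns [B <=* A X A] into
    [(A X B) B^* = B B^*] and [B^* (B X A) = B^* B], so it remains to cancel
    [B^*]. On the left this is the C^*-identity in disguise: if
    [T^* T S = T^* T] then [|T (S x - x)|^2 = <S x - x, T^* T (S x - x)> = 0]
    ([adjoint_cancell]). On the right, take adjoints ([adjoint_cancelr]).

    Cancellation needs [T^*] to be a genuine adjoint and [T^* ^* = T]. The
    adjoint is therefore constructed from the Riesz representation theorem,
    whose representing vector is obtained from the vector of minimal norm in
    the hyperplane [f x = 1]. Such a vector exists because the parallelogram
    law makes every minimizing sequence a Cauchy sequence
    ([exists_min_norm]), and minimality makes it orthogonal to the kernel of
    the functional ([min_norm_orthogonal]). *)

Import Order.TTheory GRing.Theory Num.Theory numFieldNormedType.Exports.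
Local Open Scope classical_set_scope.
Local Open Scope complex_scope.
Local Open Scope ring_scope.

Section HilbertSpace.
Set Implicit Arguments.
Unset Strict Implicit.
Context {R : realType} {H : hilbertType R}.
Implicit Types (x y z : H) (C : set H).

(** The norm of [H] takes its values in [R[i]], where infima are not available;
    this is the same norm seen in [R]. *)
Definition rnorm x : R := complex.Re `|x|.

Lemma rnormE x : (rnorm x)%:C = `|x|.
Proof. by rewrite RRe_real. Qed.

Lemma rnorm_ge0 x : 0 <= rnorm x.
Proof. by rewrite -lecR rnormE; exact: normr_ge0. Qed.

Lemma rnormD x y : rnorm (x + y) <= rnorm x + rnorm y.
Proof. by rewrite -lecR rmorphD/= !rnormE ler_normD. Qed.

Lemma parallelogram x y :
  rnorm (x + y) ^+ 2 + rnorm (x - y) ^+ 2 = 2 * rnorm x ^+ 2 + 2 * rnorm y ^+ 2.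
Proof.
apply: complexI; rewrite !(rmorphD, rmorphM)/= !rnormE -!expr2 -!inner_norm.
by rewrite dnormD dnormB/=; ring.
Qed.

(** Let [d] be the infimum of the norms over [C]. If [x] and [y] in [C] have
    norm below [d + e], their midpoint has norm at least [d], and the
    parallelogram law leaves only [4 e (2 d + e)] for [|x - y|^2]; hence a minimizing sequence
    converges, and its limit realizes [d]. Convexity enters through midpoints
    only. *)
Lemma exists_min_norm C : C !=set0 -> closed C ->
    (forall x y, C x -> C y -> C (2^-1 *: (x + y))) ->
  exists2 x, C x & forall y, C y -> `|x| <= `|y|.
Proof.
move=> C0 Ccl Cmid.
set N := rnorm @` C; set d := inf N.
have N_inf : has_inf N.
  split; first by case: C0 => x Cx; exists (rnorm x), x.
  by exists 0 => _ [x _ <-]; exact: rnorm_ge0.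
have d_le x : C x -> d <= rnorm x.
  by move=> Cx; apply: ge_inf; [case: N_inf|exists x].
have d_ge0 : 0 <= d.
  by apply: lb_le_inf => [|_ [x _ <-]]; [case: N_inf|exact: rnorm_ge0].
have /choice[u uP] (n : nat) : exists x, C x /\ rnorm x < d + n.+1%:R^-1.
  have [|_ [x Cx <-] ?] := @inf_adherent _ N n.+1%:R^-1 _ N_inf.
    by rewrite invr_gt0.
  by exists x.
have u_near (e : R) : 0 < e -> \forall n \near \oo, rnorm (u n) < d + e.
  move=> e0; near=> n; apply: lt_trans (uP n).2 _; rewrite ltrD2l.
  by near: n; exact: (near_infty_natSinv_lt (PosNum e0)).
have dist_le (e : R) x y : 0 < e -> C x -> C y ->
    rnorm x < d + e -> rnorm y < d + e ->
    rnorm (x - y) ^+ 2 <= 4 * e * (2 * d + e).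
  move=> e0 Cx Cy xd yd.
  have := d_le _ (Cmid _ _ Cx Cy).
  have -> : rnorm (2^-1 *: (x + y)) = 2^-1 * rnorm (x + y).
    apply: complexI.
    by rewrite rmorphM/= !rnormE normrZ normfV normr_nat fmorphV/= rmorph_nat.
  have := parallelogram x y; have := rnorm_ge0 x; have := rnorm_ge0 y.
  have := rnorm_ge0 (x + y).
  move: (rnorm (x + y)) (rnorm (x - y)) (rnorm x) (rnorm y) xd yd.
  by move=> s t a b ? ? ? ? ? ? ?; nra.
have /cauchy_cvgP/cvg_ex[x ux] : cauchy (u @ \oo).
  apply/cauchy_ballP => e e0.
  have eE : (complex.Re e)%:C = e by rewrite RRe_real//; exact: gtr0_real.
  rewrite -eE in e0 *; move: (complex.Re e) e0 => {eE}r; rewrite ltcR => r0.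
  (* With q = r^2 / (8 (2 d + 1)), every t <= min 1 q satisfies
     4 t (2 d + t) <= 4 t (2 d + 1) <= r^2 / 2. *)
  have [t t0 tr] : exists2 t, 0 < t & 4 * t * (2 * d + t) < r ^+ 2.
    have r20 : 0 < r ^+ 2 by rewrite exprn_gt0.
    have c0 : 0 < 8 * (2 * d + 1) by lra.
    pose q := r ^+ 2 / (8 * (2 * d + 1)).
    have q0 : 0 < q by rewrite divr_gt0.
    have qE : q * (8 * (2 * d + 1)) = r ^+ 2 by rewrite divfK ?gt_eqF.
    clearbody q; exists (Num.min 1 q); first by rewrite lt_min ltr01.
    have qc0 := mulr_gt0 q0 c0; rewrite -qE; case: (leP 1 q) => q1.
      have := ler_wpM2r (ltW c0) q1; lra.
    have := mulr_gt0 q0 (etrans (subr_gt0 _ _) q1); nra.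
  near_simpl; near=> n m; rewrite -ball_normE /= -rnormE ltcR.
  rewrite -(ltr_pXn2r (isT : (0 < 2)%N)) ?nnegrE ?rnorm_ge0 ?ltW//.
  apply: le_lt_trans tr.
  apply: (dist_le _ _ _ t0 (uP n).1 (uP m).1).
    by near: n; exact: u_near.
  by near: m; exact: u_near.
exists x; first by apply: (closed_cvg _ Ccl _ _ ux); near=> n; exact: (uP n).1.
move=> y Cy; rewrite -!rnormE lecR; apply: le_trans (d_le _ Cy).
apply/ler_addgt0Pr => e e0.
have e20 : 0 < e / 2 by rewrite divr_gt0.
near \oo => n.
have un : rnorm (u n) < d + e / 2 by near: n; exact: u_near.
have xun : rnorm (x - u n) < e / 2.
  rewrite -ltcR rnormE; near: n; move/cvgrPdist_lt: ux; apply.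
  by rewrite ltcR.
rewrite -(subrK (u n) x); apply: le_trans (rnormD _ _) _.
lra.
Unshelve. all: by end_near. Qed.

Lemma inner_inj x y : (forall z, inner z x = inner z y) -> x = y.
Proof.
move=> xy; apply/eqP; rewrite -subr_eq0 -(dnorm_eq0 (@inner R H)).
by rewrite linearBr/= xy subrr.
Qed.

(** Pythagoras for [x] split along the line of [y]: both the Cauchy-Schwarz
    inequality and the orthogonality of minimal vectors follow by comparing
    the two sides. *)
Lemma pythagoras_projection x y : y != 0 ->
  inner x x = inner (x - (inner x y / inner y y) *: y)
                    (x - (inner x y / inner y y) *: y)
              + `|inner x y| ^+ 2 / inner y y.
Proof.
move=> y0; set t := inner x y / inner y y.
have yy0 : inner y y != 0 by rewrite dnorm_eq0.
have ort : inner (x - t *: y) (t *: y) = 0.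
  by rewrite linearZr_LR linearBl/= linearZl_LR/= /t divfK// subrr mulr0.
rewrite -{1 2}(subrK (t *: y) x) hnormDd//; congr (_ + _).
rewrite /= inner_norm normrZ exprMn -inner_norm /t normrM normfV exprMn.
rewrite (ger0_norm (dnorm_ge0 _ y)).
by rewrite expr2 [in X in _ * X * _]expr2 -!mulrA mulVf ?mulr1.
Qed.

Lemma cauchy_schwarz x y : `|inner x y| <= `|x| * `|y|.
Proof.
have [->|y0] := eqVneq y 0; first by rewrite linear0r !normr0 mulr0.
rewrite -(@ler_pXn2r _ 2)// ?nnegrE ?mulr_ge0// exprMn -!inner_norm.
rewrite -ler_pdivrMr ?dnorm_gt0//.
by rewrite [leRHS](pythagoras_projection x y0) lerDr dnorm_ge0.
Qed.

(** Translating [x] by minus its projection on [y] lowers [|x|^2] by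
    [|<x, y>|^2 / <y, y>], which minimality forces to vanish. *)
Lemma min_norm_orthogonal x y :
  (forall t : R[i], `|x| <= `|x + t *: y|) -> inner x y = 0.
Proof.
move=> xmin; have [->|y0] := eqVneq y 0; first by rewrite linear0r.
have yy0 : 0 < inner y y by rewrite dnorm_gt0.
have := xmin (- (inner x y / inner y y)).
rewrite scaleNr -(@ler_pXn2r _ 2)// ?nnegrE// -!inner_norm.
rewrite {1}(pythagoras_projection x y0) gerDl pmulr_lle0 ?invr_gt0//.
by rewrite real_exprn_even_le0//= normr_eq0 => /eqP.
Qed.

(** If [m] has minimal norm in the hyperplane [f x = 1], then [m] is orthogonal
    to the kernel of [f], which contains [x - f x *: m]; hence
    [<x, m> = f x * <m, m>], and a rescaling of [m] represents [f]. *)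
Lemma riesz_representation (f : {linear H -> R[i]^o}) : continuous f ->
  exists y, forall x, f x = inner x y.
Proof.
move=> fcont; have [[x0 fx0]|f0] := pselect (exists x, f x != 0); last first.
  exists 0 => x; rewrite linear0r.
  by apply/eqP/negPn/negP => fx; apply: f0; exists x.
pose C := [set x | f x = 1].
have [||x y /= fx fy|m /= fm m_min] := @exists_min_norm C.
- by exists ((f x0)^-1 *: x0); rewrite /C /= linearZ/= /GRing.scale/= mulVf.
- apply: (@preimage_closed _ _ f [set 1]) => [x _|]; first exact: fcont.
  exact/accessible_closed_set1/hausdorff_accessible/norm_hausdorff.
- rewrite /C/= linearZ/= linearD/= fx fy /GRing.scale/= -[1 + 1]/(2%:R).
  by rewrite mulVf// pnatr_eq0.
have m0 : m != 0.
  by apply: contra_eq_neq fm => ->; rewrite linear0 eq_sym oner_neq0.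
have mm0 : inner m m != 0 by rewrite dnorm_eq0.
have ort x : inner (x - f x *: m) m = 0.
  rewrite inner_conj (@min_norm_orthogonal m) ?conjC0// => t.
  apply: m_min; rewrite /C/= linearD/= linearZ/= linearB/= linearZ/= fm.
  by rewrite /GRing.scale/= mulr1 subrr mulr0 addr0.
exists (Num.conj (inner m m)^-1 *: m) => x.
have /eqP := ort x; rewrite linearBl/= linearZl_LR/= subr_eq0 => /eqP xm.
by rewrite linearZr_LR/= conjCK xm mulrC mulfK.
Qed.

Lemma boundedOp_ge0 (T : 'B(H)) :
  exists2 M : R[i], 0 <= M & forall x, `|T x| <= M * `|x|.
Proof.
have [M TM] := boundedOpP T; exists (Num.max M 0)%:C => [|x].
  by rewrite lecR le_max lexx orbT.
by apply: le_trans (TM x) _; rewrite ler_wpM2r// lecR le_max lexx.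
Qed.

(** [S y] represents the functional [x |-> <T x, y>]. It depends linearly on [y]
    by uniqueness of the representing vector, and
    [|S y|^2 = <T (S y), y> <= M |S y| |y|] gives the bound of [T] for [S]. *)
Lemma exists_adjoint (T : 'B(H)) : exists S : 'B(H), is_adjoint T S.
Proof.
have [M M0 TM] := boundedOp_ge0 T.
have /choice[S TS] y : exists z, forall x, inner (T x) y = inner x z.
  pose f x : R[i]^o := inner (T x) y.
  have flin : linear f by move=> a u v; rewrite /f linearP inner_linearl.
  pose F : {linear H -> R[i]^o} :=
    HB.pack f (GRing.isLinear.Build R[i] H R[i]^o *:%R f flin).
  apply: (@riesz_representation F).
  apply/linear_bounded_continuous/linear_boundedP.
  near=> r => x; apply: le_trans (cauchy_schwarz _ _) _.
  apply: (@le_trans _ _ (M * `|x| * `|y|)); first by rewrite ler_wpM2r.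
  rewrite mulrAC ler_wpM2r//.
  by near: r; apply: nbhs_pinfty_ge; rewrite ger0_real// mulr_ge0.
have Slin : linear S.
  move=> a u v; apply: inner_inj => z.
  by rewrite linearDr/= linearZr_LR/= -!TS linearDr/= linearZr_LR.
pose L : {linear H -> H} :=
  HB.pack S (GRing.isLinear.Build R[i] H H *:%R S Slin).
have Lbd : exists K : R, forall x, `|L x| <= K%:C * `|x|.
  have ME : (complex.Re M)%:C = M by rewrite RRe_real// ger0_real.
  exists (complex.Re M) => y; rewrite ME /=.
  have [->|Sy0] := eqVneq (S y) 0; first by rewrite normr0 mulr_ge0.
  have SyE : `|S y| * `|S y| = `|inner (T (S y)) y|.
    by rewrite TS inner_norm normrX normr_id.
  rewrite -(@ler_pM2l _ `|S y|) ?normr_gt0// SyE.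
  apply: le_trans (cauchy_schwarz _ _) _.
  by rewrite mulrA ler_wpM2r// mulrC.
by exists (BoundedOp Lbd) => x y; exact: TS.
Unshelve. all: by end_near. Qed.

Local Open Scope operator_scope.

Lemma adjointP (T : 'B(H)) : is_adjoint T (T^*).
Proof. by have [S TS] := exists_adjoint T; apply: (xgetI _ TS). Qed.

Lemma adjointK (T : 'B(H)) : T^* ^* = T.
Proof.
apply: (is_adjoint_unique (@adjointP (T^*))) => x y.
by rewrite inner_conj -adjointP -inner_conj.
Qed.

Lemma comp_opA (S T U : 'B(H)) : S * (T * U) = S * T * U.
Proof. exact/boundedOp_eqP. Qed.

Lemma adjoint_comp (S T : 'B(H)) : (S * T)^* = T^* * S^*.
Proof.
apply: (is_adjoint_unique (@adjointP (S * T))) => x y.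
by rewrite /= !adjointP.
Qed.

(** [T (S x - x)] has norm zero because
    [|T (S x - x)|^2 = <S x - x, T^* T (S x - x)>]. *)
Lemma adjoint_cancell (S T : 'B(H)) : T^* * T * S = T^* * T -> T * S = T.
Proof.
move=> /boundedOp_eqP eqT; apply/boundedOp_eqP => x /=; apply/eqP.
rewrite -subr_eq0 -linearB -(dnorm_eq0 (@inner R H)) /= adjointP !linearB/=.
by have /= -> := eqT x; rewrite subrr linear0r.
Qed.

Lemma adjoint_cancelr (S T : 'B(H)) : S * T * T^* = T * T^* -> S * T = T.
Proof.
move=> /(congr1 adjoint); rewrite !adjoint_comp !adjointK comp_opA => eqT.
by rewrite -[LHS]adjointK adjoint_comp (@adjoint_cancell (S^*) (T^*)) ?adjointK.
Qed.

End HilbertSpace.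

Theorem theorem3p6 (R : realType) (H : hilbertType R) (A B : 'B(H)) :
  (B <=* A)%Op ->
  forall X : 'B(H),
    (B * X * A = B /\ B = A * X * B)%Op <-> (B <=* A * X * A)%Op.
Proof.
move=> [BB_AB BB_BA] X; split=> [[BXA AXB]|[BB_AXAB BB_BAXA]]; split.
- by rewrite -comp_opA -BB_AB comp_opA -AXB.
- by rewrite !comp_opA -BB_BA -!comp_opA [(B * _)%Op]comp_opA BXA.
- apply: (etrans (esym (comp_opA _ _ _))); apply: adjoint_cancell.
  by rewrite BB_BA -comp_opA (comp_opA A) -BB_BAXA.
- symmetry; apply: adjoint_cancelr.
  by rewrite -comp_opA BB_AB comp_opA -BB_AXAB.
Qed.
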